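(* Let $K\in\mathbb{R}^{N\times N}$ be a kernel matrix and $\tilde K\in\mathbb{R}^{N\times N}$ a rank-$r$ partial Cholesky approximation of $K$ (as specified in the context), so that in particular $K\geq\tilde K\geq 0$ in the positive semidefinite order. Assume that $r$ is large enough such that $\tilde d_i=(\tilde K1_N)_i>0$ and $\tilde q_i=(\tilde K\tilde D^{-1}1_N)_i>0$ for all $i\in\{0,\ldots,N-1\}$. Then the normalized matrices $P=D^{-1}KQ^{-1}KD^{-1}$ and $\tilde P=\tilde D^{-1}\tilde K\tilde Q^{-1}\tilde K\tilde D^{-1}$ satisfy $$\lVert P-\tilde P\rVert_*\leq(1+\lVert\tilde G\rVert)\Bigl[\frac{1}{\sqrt{q_{\min}}\,d_{\min}}+\frac{\sqrt{N}\operatorname{tr}(K)}{\sqrt{\delta_q}\,\delta_d^2}+\frac{\sqrt{N}\operatorname{tr}(K)}{2\delta_q^{3/2}\delta_d^2}\Bigl(1+\frac{\lVert K\rVert}{\delta_d}\Bigr)\Bigr]\operatorname{tr}(K-\tilde K),$$ where $\tilde G=\tilde Q^{-1/2}\tilde K\tilde D^{-1}$.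
   Context: Setting. Let $k\colon\mathbb{R}^d\times\mathbb{R}^d\to\mathbb{R}$ be a kernel function that is continuous, bounded and positive semidefinite (symmetric, with positive semidefinite kernel matrices), with $k(u,v)>0$ for all $u,v\in\mathbb{R}^d$. Given samples $u_0,\ldots,u_{N-1}\in\mathbb{R}^d$, $N\in\mathbb{N}$, the kernel matrix is $K\in\mathbb{R}^{N\times N}$ with entries $K_{ij}=k(u_i,u_j)$; it is symmetric positive semidefinite with positive entries. A rank-$r$ partial Cholesky approximation ($r<N$) is a matrix $\tilde K=FF^\top$ with $F\in\mathbb{R}^{N\times r}$; it is a standing assumption that $K\geq\tilde K\geq 0$ in the positive semidefinite (Loewner) order, i.e. $\tilde K$ and $K-\tilde K$ are positive semidefinite. Notation. $1_N\in\mathbb{R}^N$ is the vector of ones. Diagonal matrices: $D=\operatorname{diag}(K1_N)$, $Q=\operatorname{diag}(KD^{-1}1_N)$, $\tilde D=\operatorname{diag}(\tilde K1_N)$, $\tilde Q=\operatorname{diag}(\tilde K\tilde D^{-1}1_N)$, with respective diagonal entries $d_i>0$, $q_i>0$, $\tilde d_i$, $\tilde q_i$. Set $d_{\min}=\min_i d_i$, $\tilde d_{\min}=\min_i\tilde d_i$, $\delta_d=\min(d_{\min},\tilde d_{\min})$, $q_{\min}=\min_i q_i$, $\tilde q_{\min}=\min_i\tilde q_i$, $\delta_q=\min(q_{\min},\tilde q_{\min})$, minima over $0\leq i<N$. $\lVert\cdot\rVert$ is the operator (spectral) norm and $\lVert\cdot\rVert_*$ the trace (nuclear) norm. *)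

(* Defs.v *)
From mathcomp Require Import all_boot all_order all_algebra.
From mathcomp Require Import boolp classical_sets reals topology normedtype exp.

Set Implicit Arguments.
Unset Strict Implicit.
Unset Printing Implicit Defensive.

Import Order.TTheory GRing.Theory Num.Theory.
Import numFieldNormedType.Exports.
Local Open Scope classical_set_scope.
Local Open Scope ring_scope.

Definition psd (R : realType) (n : nat) (A : 'M[R]_n) : Prop :=
  A^T = A /\ forall x : 'cV[R]_n, 0 <= (x^T *m A *m x) 0 0.

Definition loewner_le (R : realType) (n : nat) (A B : 'M[R]_n) : Prop :=
  psd (B - A).

Definition l2norm (R : realType) (n : nat) (x : 'cV[R]_n) : R :=
  Num.sqrt (\sum_i x i 0 ^+ 2).

(* The norm `|A| that the library puts on matrices is the entrywise maximum,
   hence the separate definition of the spectral norm. *)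
Definition opnorm (R : realType) (m n : nat) (A : 'M[R]_(m, n)) : R :=
  sup [set l2norm (A *m x) | x in [set x : 'cV[R]_n | l2norm x <= 1]].

(* The positive semidefinite square root, which exists and is unique when A is
   positive semidefinite; the default value 0 is only reached for other A. *)
Definition mxsqrt (R : realType) (n : nat) (A : 'M[R]_n) : 'M[R]_n :=
  xget 0 [set S | psd S /\ S *m S = A].

(* tr |A| with |A| = (A^T A)^(1/2), i.e. the sum of the singular values of A. *)
Definition trace_norm (R : realType) (m n : nat) (A : 'M[R]_(m, n)) : R :=
  \tr (mxsqrt (A^T *m A)).

(* The value for n = 0 is 0. *)
Definition vmin (R : realType) (n : nat) (v : 'cV[R]_n) : R :=
  let s := [seq v i 0 | i : 'I_n] in \big[Num.min/head 0 s]_(x <- s) x.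

Definition kernel_mx (R : realType) (d N : nat)
    (k : 'rV[R]_d -> 'rV[R]_d -> R) (u : 'I_N -> 'rV[R]_d) : 'M[R]_N :=
  \matrix_(i, j) k (u i) (u j).

Record admissible_kernel (R : realType) (d : nat)
    (k : 'rV[R]_d -> 'rV[R]_d -> R) : Prop := {
  kernel_continuous :
    continuous (fun p : 'rV[R]_d * 'rV[R]_d => k p.1 p.2);
  kernel_bounded : exists M : R, forall x y, `|k x y| <= M;
  kernel_sym : forall x y, k x y = k y x;
  kernel_psd : forall (n : nat) (x : 'I_n -> 'rV[R]_d), psd (kernel_mx k x);
  kernel_pos : forall x y, 0 < k x y
}.

Record partial_cholesky (R : realType) (N r : nat) (K Kt : 'M[R]_N) : Prop := {
  cholesky_rank : (r < N)%N;
  cholesky_factor : exists F : 'M[R]_(N, r), Kt = F *m F^T;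
  cholesky_ge0 : loewner_le 0 Kt;
  cholesky_le : loewner_le Kt K
}.

Definition diagc (R : realType) (n : nat) (v : 'cV[R]_n) : 'M[R]_n :=
  diag_mx v^T.

Definition ones (R : realType) (n : nat) : 'cV[R]_n := const_mx 1.

Definition dvec (R : realType) (n : nat) (A : 'M[R]_n) : 'cV[R]_n :=
  A *m ones R n.

Definition qvec (R : realType) (n : nat) (A : 'M[R]_n) : 'cV[R]_n :=
  A *m invmx (diagc (dvec A)) *m ones R n.

Definition normalized (R : realType) (n : nat) (A : 'M[R]_n) : 'M[R]_n :=
  let D := diagc (dvec A) in
  let Q := diagc (qvec A) in
  invmx D *m A *m invmx Q *m A *m invmx D.

(* Q^(-1/2) A D^(-1), the inverse square root of the diagonal matrix Q being
   taken entrywise. *)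
Definition Gmx (R : realType) (n : nat) (A : 'M[R]_n) : 'M[R]_n :=
  diagc (map_mx (fun x => (Num.sqrt x)^-1) (qvec A)) *m A
    *m invmx (diagc (dvec A)).

(* Main.v *)
(** Write P = G^T G with G = Q^(-1/2) K D^(-1), and likewise for the
    approximation Kt. By duality with the operator norm the trace norm of
    P - Pt is at most (|G| + |Gt|) times that of G - Gt, and |G| <= 1 because
    P is symmetric and stochastic. Finally, G - Gt is the sum of
      Q^(-1/2) (K - Kt) D^(-1),
      Q^(-1/2) Kt (D^(-1) - Dt^(-1)) and
      (Q^(-1/2) - Qt^(-1/2)) Kt Dt^(-1);
    in each term the middle factor is positive semidefinite, so its trace norm
    is its trace, and the diagonal factors are controlled entrywise, using
    |(K - Kt) 1| <= sqrt N tr (K - Kt). *)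

Require Import Defs.
From mathcomp Require Import all_boot all_order all_algebra ring lra.
From mathcomp Require Import boolp classical_sets reals exp.

Import Order.TTheory GRing.Theory Num.Theory.
Local Open Scope ring_scope.

(** * Cauchy-Schwarz and the Euclidean norm *)

Lemma cauchy_schwarz_sum (R : realDomainType) (I : finType) (a b : I -> R) :
  (\sum_i a i * b i) ^+ 2 <= (\sum_i a i ^+ 2) * (\sum_i b i ^+ 2).
Proof.
set m := \sum_i a i * b i; set A := \sum_i a i ^+ 2; set B := \sum_i b i ^+ 2.
have A0 : 0 <= A by apply: sumr_ge0 => i _; exact: sqr_ge0.
have [A_eq0|A_neq0] := eqVneq A 0.
  suff -> : m = 0 by rewrite A_eq0 mul0r expr0n.
  rewrite /m big1 // => i _.
  have /eqP := A_eq0; rewrite psumr_eq0 => [|j _]; last exact: sqr_ge0.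
  by move=> /allP /(_ i (mem_index_enum _)); rewrite sqrf_eq0 => /eqP ->; rewrite mul0r.
have A_gt0 : 0 < A by rewrite lt_def A_neq0.
(* This sum expands to [A * (A * B - m ^+ 2)], and [A] is positive here. *)
have : 0 <= \sum_i (A * b i - m * a i) ^+ 2 by apply: sumr_ge0 => i _; exact: sqr_ge0.
have -> : \sum_i (A * b i - m * a i) ^+ 2
    = A ^+ 2 * B - (2 * A * m) * m + m ^+ 2 * A.
  transitivity (\sum_i (A ^+ 2 * b i ^+ 2 + - (2 * A * m) * (a i * b i)
                         + m ^+ 2 * a i ^+ 2)).
    by apply: eq_bigr => i _; ring.
  by rewrite !big_split /= -!mulr_sumr mulNr.
have -> : A ^+ 2 * B - 2 * A * m * m + m ^+ 2 * A = A * (A * B - m ^+ 2) by ring.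
by rewrite pmulr_rge0 // subr_ge0.
Qed.

Section EuclideanNorm.
Context {R : realType} {n : nat}.
Implicit Types (x y : 'cV[R]_n) (c : R).

Lemma l2norm_ge0 x : 0 <= l2norm x.
Proof. exact: sqrtr_ge0. Qed.

Lemma sqr_l2norm x : l2norm x ^+ 2 = \sum_i x i 0 ^+ 2.
Proof. by rewrite sqr_sqrtr //; apply: sumr_ge0 => i _; exact: sqr_ge0. Qed.

Lemma dotE x y : (x^T *m y) 0 0 = \sum_i x i 0 * y i 0.
Proof. by rewrite mxE; apply: eq_bigr => i _; rewrite mxE. Qed.

Lemma sqr_l2norm_dot x : l2norm x ^+ 2 = (x^T *m x) 0 0.
Proof. by rewrite dotE sqr_l2norm; apply: eq_bigr => i _; rewrite expr2. Qed.

Lemma dot_le_l2norm x y : (x^T *m y) 0 0 <= l2norm x * l2norm y.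
Proof.
apply: le_trans (ler_norm _) _.
rewrite -ler_sqr ?nnegrE ?mulr_ge0 ?l2norm_ge0 //.
by rewrite real_normK ?num_real // exprMn !sqr_l2norm dotE cauchy_schwarz_sum.
Qed.

Lemma normr_le_l2norm x i : `|x i 0| <= l2norm x.
Proof.
rewrite -ler_sqr ?nnegrE ?l2norm_ge0 // real_normK ?num_real // sqr_l2norm (bigD1 i) //=.
by rewrite lerDl; apply: sumr_ge0 => j _; exact: sqr_ge0.
Qed.

Lemma l2normZ c x : l2norm (c *: x) = `|c| * l2norm x.
Proof.
apply/eqP; rewrite -(@eqrXn2 _ 2) ?mulr_ge0 ?l2norm_ge0 // exprMn real_normK ?num_real //.
rewrite !sqr_l2norm mulr_sumr; apply/eqP/eq_bigr => i _.
by rewrite mxE exprMn.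
Qed.

Lemma l2normD x y : l2norm (x + y) <= l2norm x + l2norm y.
Proof.
rewrite -ler_sqr ?nnegrE ?addr_ge0 ?l2norm_ge0 //.
have := dot_le_l2norm x y.
have -> : l2norm (x + y) ^+ 2 = l2norm x ^+ 2 + 2 * (x^T *m y) 0 0 + l2norm y ^+ 2.
  rewrite !sqr_l2norm dotE mulr_sumr -!big_split /=.
  by apply: eq_bigr => i _; rewrite mxE; ring.
by move=> ?; rewrite sqrrD; lra.
Qed.

Lemma l2norm_ones : l2norm (ones R n) = Num.sqrt n%:R.
Proof.
rewrite /l2norm; under eq_bigr do rewrite mxE expr1n.
by rewrite sumr_const card_ord.
Qed.

End EuclideanNorm.

(** Bounding all vectors avoids the supremum in [opnorm], so that bounds compose directly. *)
Definition opbound {R : realType} {m n : nat} (c : R) (A : 'M[R]_(m, n)) : Prop :=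
  forall x, l2norm (A *m x) <= c * l2norm x.

(** * Calculus of operator bounds *)

Section OperatorBounds.
Context {R : realType}.

Lemma opbound_mul {m n p : nat} {a b : R} (A : 'M[R]_(m, n)) (B : 'M_(n, p)) :
  0 <= a -> opbound a A -> opbound b B -> opbound (a * b) (A *m B).
Proof.
move=> a0 hA hB x; rewrite -mulmxA -mulrA.
by apply: le_trans (hA _) _; rewrite ler_wpM2l.
Qed.

(** With z = A^T y, |z|^2 is the inner product of y and A z, hence at most c |y| |z|; divide by
    |z|. *)
Lemma opbound_trmx {m n : nat} {c : R} (A : 'M[R]_(m, n)) :
  0 <= c -> opbound c A -> opbound c A^T.
Proof.
move=> c0 hA y; set z := A^T *m y.
have [z0|z_neq0] := eqVneq (l2norm z) 0; first by rewrite z0 mulr_ge0 ?l2norm_ge0.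
have z_gt0 : 0 < l2norm z by rewrite lt_def z_neq0 l2norm_ge0.
rewrite -(ler_pM2r z_gt0) -expr2 sqr_l2norm_dot {1}/z trmx_mul trmxK -mulmxA.
apply: le_trans (dot_le_l2norm _ _) _.
by rewrite mulrAC mulrC ler_wpM2r ?l2norm_ge0 // hA.
Qed.

Lemma opbound_diag {n : nat} {c : R} (v : 'cV[R]_n) :
  0 <= c -> (forall i, `|v i 0| <= c) -> opbound c (diagc v).
Proof.
move=> c0 hv x; rewrite -ler_sqr ?nnegrE ?mulr_ge0 ?l2norm_ge0 //.
rewrite exprMn !sqr_l2norm mulr_sumr; apply: ler_sum => i _.
rewrite mul_diag_mx !mxE exprMn ler_wpM2r ?sqr_ge0 //.
by rewrite -(real_normK (num_real (v i 0))) ler_sqr ?nnegrE // hv.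
Qed.

(** Cauchy-Schwarz in each row. This makes the set in [opnorm] bounded, so that its supremum is an
    upper bound. *)
Lemma opbound_frobenius {m n : nat} (A : 'M[R]_(m, n)) :
  opbound (Num.sqrt (\sum_i \sum_j A i j ^+ 2)) A.
Proof.
move=> x; rewrite -ler_sqr ?nnegrE ?mulr_ge0 ?l2norm_ge0 ?sqrtr_ge0 //.
rewrite exprMn !sqr_l2norm sqr_sqrtr; last first.
  by apply: sumr_ge0 => i _; apply: sumr_ge0 => j _; exact: sqr_ge0.
rewrite mulr_suml; apply: ler_sum => i _.
by rewrite mxE cauchy_schwarz_sum.
Qed.

Lemma opnorm_ub {m n : nat} (A : 'M[R]_(m, n)) (x : 'cV[R]_n) :
  l2norm x <= 1 -> l2norm (A *m x) <= opnorm A.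
Proof.
move=> x1; apply: ub_le_sup; last by exists x.
exists (Num.sqrt (\sum_i \sum_j A i j ^+ 2)) => _ [y /= y1 <-].
apply: le_trans (opbound_frobenius _ y) _.
by rewrite ler_piMr ?sqrtr_ge0.
Qed.

Lemma l2norm0 {n : nat} : l2norm (0 : 'cV[R]_n) = 0.
Proof. by rewrite -(scale0r 0) l2normZ normr0 mul0r. Qed.

Lemma opnorm_ge0 {m n : nat} (A : 'M[R]_(m, n)) : 0 <= opnorm A.
Proof. by have := @opnorm_ub _ _ A 0; rewrite mulmx0 !l2norm0; apply. Qed.

Lemma opbound_opnorm {m n : nat} (A : 'M[R]_(m, n)) : opbound (opnorm A) A.
Proof.
move=> x; have [x0|x_neq0] := eqVneq (l2norm x) 0.
  (* A vector of norm 0 cannot be rescaled to norm 1; any finite bound settles this case. *)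
  have := opbound_frobenius A x.
  by rewrite x0 !mulr0.
have x_gt0 : 0 < l2norm x by rewrite lt_def x_neq0 l2norm_ge0.
rewrite -ler_pdivrMr // mulrC -[_^-1]ger0_norm ?invr_ge0 ?l2norm_ge0 //.
rewrite -l2normZ scalemxAr; apply: opnorm_ub.
by rewrite l2normZ ger0_norm ?invr_ge0 ?l2norm_ge0 // mulVf.
Qed.

End OperatorBounds.

(** * Positive semidefinite matrices, traces and duality *)

Section PositiveSemidefinite.
Context {R : realType} {n : nat}.
Implicit Types (A B C : 'M[R]_n) (x y : 'cV[R]_n).

Lemma trmxBZ x y (c : R) : (x - c *: y)^T = x^T - c *: y^T.
Proof. by apply/rowP => i; rewrite !mxE. Qed.

Lemma psd_diag_ge0 B i : psd B -> 0 <= B i i.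
Proof.
move=> [_ /(_ (delta_mx i 0))].
by rewrite trmx_delta -rowE -colE !mxE.
Qed.

Lemma psd_trace_ge0 B : psd B -> 0 <= \tr B.
Proof. by move=> hB; apply: sumr_ge0 => i _; exact: psd_diag_ge0. Qed.

Lemma psd_entry_sym B i j : psd B -> B i j = B j i.
Proof. by move=> [sB _]; rewrite -[in LHS]sB mxE. Qed.

(* Eliminating one pivot, as in the Cholesky algorithm. *)
Lemma psd_pivot B i : psd B -> B i i != 0 ->
  psd (B - (B i i)^-1 *: (col i B *m (col i B)^T)).
Proof.
move=> [sB hB] Bii; split.
  by rewrite linearB linearZ /= trmx_mul trmxK sB.
move=> x; set e : 'cV[R]_n := delta_mx i 0.
have trE (M : 'M[R]_1) : M^T 0 0 = M 0 0 by rewrite mxE.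
have subE (M M' : 'M[R]_1) : (M - M') 0 0 = M 0 0 - M' 0 0 by rewrite !mxE.
have scaleE s (M : 'M[R]_1) : (s *: M) 0 0 = s * M 0 0 by rewrite !mxE.
set t := (x^T *m B *m e) 0 0.
have exE : (e^T *m B *m x) 0 0 = t.
  by rewrite -trE !trmx_mul trmxK sB mulmxA.
have eeE : (e^T *m B *m e) 0 0 = B i i.
  by rewrite trmx_delta -rowE -colE !mxE.
(* This point minimizes the form of [B] on the line through [x] in direction [e]; the minimum is the
   form of the pivoted matrix at [x]. *)
have := hB (x - (t / B i i) *: e).
rewrite trmxBZ !(mulmxBl, mulmxBr) -!(scalemxAl, scalemxAr).
rewrite !(subE, scaleE) exE eeE -/t mulmxA.
have -> : (x^T *m col i B *m (col i B)^T *m x) 0 0 = t ^+ 2.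
  rewrite colE -mulmxA [LHS]mxE big_ord1 [(_ *m x) 0 0](_ : _ = t).
    by rewrite mulmxA expr2.
  by rewrite trmx_mul sB exE.
move: (B i i) Bii => b b0; set X := (_ *m x) 0 0 => H.
by apply: le_trans H _; rewrite le_eqVlt; apply/orP; left; apply/eqP; field.
Qed.

Lemma psd_diag_eq0 B i j : psd B -> B i i = 0 -> B i j = 0.
Proof.
move=> psdB Bii; have [//|Bij] := eqVneq (B i j) 0.
(* The coefficient is chosen so that the form takes the value -1 at this vector. *)
have [_ /(_ (delta_mx j 0 - ((B j j + 1) / (2 * B i j)) *: delta_mx i 0))] := psdB.
rewrite trmxBZ !(mulmxBl, mulmxBr).
rewrite -!(scalemxAl, scalemxAr) !trmx_delta -!rowE -!colE !mxE.
rewrite (psd_entry_sym _ j i psdB) Bii.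
set c := (_ / _); have -> : c = (B j j + 1) / (2 * B i j) by [].
move: (B j j) (B i j) Bij => bjj bij bij0.
rewrite (_ : _ - _ = -1); last by field.
by rewrite ler0N1.
Qed.

(** Induction on the number of nonzero diagonal entries: a pivot clears one of them and keeps the
    zero ones, and a zero diagonal forces B = 0. *)
Lemma psd_sum_rank1 B : psd B ->
  exists s : seq 'cV[R]_n, B = \sum_(f <- s) f *m f^T.
Proof.
have [k] := ubnP #|[set i | B i i != 0]|.
elim: k B => // k IH B hk hB.
have [[i Bii]|B0] := pselect (exists i, B i i != 0); last first.
  exists [::]; rewrite big_nil; apply/matrixP => i j; rewrite mxE.
  apply: psd_diag_eq0 => //; apply/eqP/negP => /negP Bii.
  by apply: B0; exists i.
have hB' := psd_pivot _ _ hB Bii.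
have B_gt0 : 0 < B i i by rewrite lt_def Bii psd_diag_ge0.
have [s sE] : exists s : seq 'cV[R]_n,
    B - (B i i)^-1 *: (col i B *m (col i B)^T) = \sum_(f <- s) f *m f^T.
  apply: IH => //; rewrite -ltnS; apply: leq_trans hk; rewrite ltnS.
  apply: proper_card; apply/properP; split; last first.
    exists i; rewrite inE // negbK !mxE big_ord1 !mxE.
    by rewrite mulrA mulVf // mul1r subrr.
  apply/fintype.subsetP => j; rewrite !inE; apply: contra_neq => Bjj.
  rewrite !mxE big_ord1 !mxE (psd_diag_eq0 _ _ _ hB Bjj) Bjj.
  by rewrite mul0r mulr0 subrr.
exists ((Num.sqrt (B i i))^-1 *: col i B :: s).
rewrite big_cons -sE linearZ /= -scalemxAl -scalemxAr scalerA -invfM -expr2.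
by rewrite sqr_sqrtr ?ltW // addrC subrK.
Qed.

(** For B = f f^T the left side is f^T C f, at most c |f|^2; sum over a rank-one decomposition. *)
Lemma psd_trace_mul_le C B c : opbound c C -> psd B ->
  \tr (C *m B) <= c * \tr B.
Proof.
move=> hC /psd_sum_rank1 [s ->].
rewrite mulmx_sumr !raddf_sum /= mulr_sumr; apply: ler_sum => f _.
rewrite mulmxA !(mxtrace_mulC _ f^T) !/mxtrace !big_ord1.
apply: le_trans (dot_le_l2norm _ _) _.
by rewrite -sqr_l2norm_dot expr2 mulrCA ler_wpM2l ?l2norm_ge0.
Qed.

(** Test the previous trace bound on C = x z^T with z = B x: this C has bound |x| |z|, and tr (C B)
    = |z|^2. *)
Lemma psd_opbound B : psd B -> opbound (\tr B) B.
Proof.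
move=> psdB x; set z := B *m x.
have [z0|z_neq0] := eqVneq (l2norm z) 0.
  by rewrite z0 mulr_ge0 ?l2norm_ge0 ?psd_trace_ge0.
have z_gt0 : 0 < l2norm z by rewrite lt_def z_neq0 l2norm_ge0.
have xz : opbound (l2norm x * l2norm z) (x *m z^T).
  move=> y; rewrite -mulmxA (mx11_scalar (z^T *m y)) mul_mx_scalar l2normZ.
  rewrite mulrC -mulrA ler_wpM2l ?l2norm_ge0 // ler_norml dot_le_l2norm andbT.
  have := dot_le_l2norm (- z) y.
  rewrite linearN mulNmx mxE -scaleN1r l2normZ normrN1 mul1r; lra.
have := psd_trace_mul_le _ _ _ xz psdB.
rewrite -mulmxA mxtrace_mulC -mulmxA /mxtrace big_ord1 -sqr_l2norm_dot expr2.
rewrite mulrAC ler_pM2r // mulrC //.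
Qed.

(* Duality between the trace norm and the operator norm. For S = |A| the
   contractions W = A (S + e)^-1 satisfy tr (W^T A) >= tr S - n e, which
   replaces the polar decomposition. That |A| exists is not needed: otherwise
   mxsqrt returns its default value 0, whose trace is bounded by taking W = 0. *)
Lemma trace_norm_le A c :
  (forall W, opbound 1 W -> \tr (W *m A) <= c) -> trace_norm A <= c.
Proof.
move=> H; rewrite /trace_norm /mxsqrt; case: xgetP => [S _ [psdS SS]|_]; last first.
  rewrite mxtrace0 -(mxtrace0 R n) -(mul0mx n A); apply: H => x.
  by rewrite mul0mx l2norm0 mul1r l2norm_ge0.
apply/ler_addgt0Pr => d d_gt0.
(* The divisor [n.+1] keeps [e] positive when n = 0. *)
pose e := d / n.+1%:R.
have e_gt0 : 0 < e by rewrite divr_gt0.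
have ned : n%:R * e <= d.
  rewrite /e mulrCA ler_piMr ?(ltW d_gt0) // ler_pdivrMr // mul1r ler_nat //.
pose T := S + e%:M.
have [sS hS] := psdS.
have sT : T^T = T by rewrite /T linearD /= sS tr_scalar_mx.
(* The cross term 2 e y^T S y is nonnegative. This inequality yields both the invertibility of [T]
   and, as |A y| = |S y|, the contraction property. *)
have T_ge y : l2norm (S *m y) ^+ 2 + e ^+ 2 * l2norm y ^+ 2 <= l2norm (T *m y) ^+ 2.
  rewrite [T *m y]mulmxDl mul_scalar_mx.
  have -> : l2norm (S *m y + e *: y) ^+ 2 = l2norm (S *m y) ^+ 2
      + 2 * e * (y^T *m S *m y) 0 0 + e ^+ 2 * l2norm y ^+ 2.
    rewrite -mulmxA !sqr_l2norm dotE !mulr_sumr -!big_split /=.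
    by apply: eq_bigr => i _; rewrite [in LHS]mxE [(e *: y) _ _]mxE; ring.
  rewrite lerD2r lerDl mulr_ge0 ?hS // mulr_ge0 // ltW //.
have Tu : T \in unitmx.
  rewrite -row_free_unit -kermx_eq0; apply/eqP/row_matrixP => i.
  rewrite row0; set r := row i _.
  have rT : r *m T = 0 by apply/eqP; rewrite -sub_kermx row_sub.
  have Tr : T *m r^T = 0 by rewrite -[LHS]trmxK trmx_mul trmxK sT rT trmx0.
  have := T_ge r^T; rewrite Tr l2norm0 expr0n /= => H0.
  have : l2norm r^T ^+ 2 <= 0.
    rewrite -(pmulr_rle0 _ (exprn_gt0 2 e_gt0)); apply: le_trans H0.
    by rewrite lerDr sqr_ge0.
  rewrite exprn_even_le0 //= => /eqP r0.
  apply/rowP => j; rewrite [RHS]mxE; apply/eqP; rewrite -normr_le0.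
  by have := normr_le_l2norm r^T j; rewrite r0 mxE.
have SVT : S *m invmx T = 1%:M - e *: invmx T.
  by rewrite -[S](addrK e%:M) -/T mulmxBl mulmxV // mul_scalar_mx.
have hW : opbound 1 (A *m invmx T)^T.
  apply: opbound_trmx => // x; rewrite mul1r.
  rewrite -ler_sqr ?nnegrE ?l2norm_ge0 // -mulmxA.
  rewrite -[in leRHS](mulKVmx Tu x); move: (invmx T *m x) => y.
  apply: le_trans (T_ge y); rewrite !sqr_l2norm_dot !trmx_mul.
  rewrite -!mulmxA (mulmxA A^T) -SS sS -!mulmxA.
  by rewrite lerDl -sqr_l2norm_dot mulr_ge0 ?sqr_ge0.
have := H _ hW.
rewrite trmx_mul trmx_inv sT -mulmxA -SS mulmxA mxtrace_mulC mulmxA SVT => Hc.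
(* Using [SVT] twice, the trace on the right equals tr S - n e + e^2 tr T^-1, and T^-1 is positive
   semidefinite. *)
have : \tr S <= \tr ((1%:M - e *: invmx T) *m S) + n%:R * e; last by lra.
rewrite mulmxBl mul1mx raddfB /= -scalemxAl mxtraceZ mxtrace_mulC SVT.
rewrite raddfB /= mxtrace1 mxtraceZ.
have : 0 <= \tr (invmx T).
  apply: psd_trace_ge0; split; first by rewrite trmx_inv sT.
  move=> x; rewrite -mulmxA -[x in x^T](mulKVmx Tu x); move: (invmx T *m x) => y.
  rewrite trmx_mul sT -mulmxA [T *m y]mulmxDl mul_scalar_mx mulmxDr -scalemxAr mulmxA.
  rewrite mxE addr_ge0 ?hS // mxE -sqr_l2norm_dot mulr_ge0 ?sqr_ge0 // ltW //.
move: e_gt0; set t := \tr _ => e_gt0 t0.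
have : 0 <= e * (e * t) by exact: (mulr_ge0 (ltW e_gt0) (mulr_ge0 (ltW e_gt0) t0)).
rewrite mulrBr (mulrC n%:R); lra.
Qed.

End PositiveSemidefinite.

(** * Diagonal scalings and the factor G *)

Definition invc {R : realType} {n : nat} (v : 'cV[R]_n) : 'cV[R]_n :=
  map_mx GRing.inv v.

Definition rsqrtc {R : realType} {n : nat} (v : 'cV[R]_n) : 'cV[R]_n :=
  map_mx (fun x => (Num.sqrt x)^-1) v.

Section Normalization.
Context {R : realType} {n : nat}.
Implicit Types (A B : 'M[R]_n) (v w : 'cV[R]_n).

Lemma invcE v i : invc v i 0 = (v i 0)^-1.
Proof. by rewrite mxE. Qed.

Lemma rsqrtcE v i : rsqrtc v i 0 = (Num.sqrt (v i 0))^-1.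
Proof. by rewrite mxE. Qed.

Lemma colBE v w i : (v - w) i 0 = v i 0 - w i 0.
Proof. by rewrite !mxE. Qed.

Lemma diagcB v w : diagc (v - w) = diagc v - diagc w.
Proof. by rewrite /diagc !linearB. Qed.

Lemma trmx_diagc v : (diagc v)^T = diagc v.
Proof. exact: tr_diag_mx. Qed.

Lemma diagc_mul v w : diagc v *m diagc w = diagc (\col_i (v i 0 * w i 0)).
Proof.
rewrite /diagc mulmx_diag; congr diag_mx.
by apply/rowP => i; rewrite !mxE.
Qed.

Lemma diagc_mulmx v w : diagc v *m w = \col_i (v i 0 * w i 0).
Proof. by apply/colP => i; rewrite mul_diag_mx !mxE. Qed.

Lemma invmx_diagc v : (forall i, v i 0 != 0) -> invmx (diagc v) = diagc (invc v).
Proof.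
move=> v0; have vV : diagc v *m diagc (invc v) = 1%:M.
  rewrite diagc_mul -diag_const_mx; congr diag_mx.
  by apply/rowP => i; rewrite !mxE mulfV.
have [vu _] := mulmx1_unit vV.
by rewrite -[RHS](mulKmx vu) vV mulmx1.
Qed.

Lemma dvecE A i : dvec A i 0 = \sum_j A i j.
Proof. by rewrite mxE; apply: eq_bigr => j _; rewrite mxE mulr1. Qed.

Lemma qvec_invc A : (forall i, 0 < dvec A i 0) -> qvec A = A *m invc (dvec A).
Proof.
move=> d_gt0; rewrite /qvec invmx_diagc => [|i]; last exact: lt0r_neq0.
rewrite -mulmxA diagc_mulmx; congr (_ *m _).
by apply/colP => i; rewrite !mxE mulr1.
Qed.

Lemma GmxE A : (forall i, 0 < dvec A i 0) ->
  Gmx A = diagc (rsqrtc (qvec A)) *m A *m diagc (invc (dvec A)).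
Proof. by move=> d_gt0; rewrite /Gmx invmx_diagc // => i; exact: lt0r_neq0. Qed.

Lemma normalized_Gmx A : A^T = A ->
  (forall i, 0 < dvec A i 0) -> (forall i, 0 < qvec A i 0) ->
  normalized A = (Gmx A)^T *m Gmx A.
Proof.
move=> sA d_gt0 q_gt0; rewrite GmxE // /normalized.
rewrite !invmx_diagc => [|i|i]; try exact: lt0r_neq0.
rewrite !trmx_mul sA !trmx_diagc !mulmxA; do 2!congr (_ *m _).
rewrite -[RHS]mulmxA diagc_mul; congr (_ *m _); congr diagc.
apply/colP => i; rewrite [LHS]mxE [RHS]mxE rsqrtcE -invfM -expr2.
by rewrite sqr_sqrtr // ltW.
Qed.

(* Weighted Cauchy-Schwarz in each row, the weights being A i j / d j with
   total q i; each column of A / d sums to 1. *)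
Lemma opbound_Gmx A : A^T = A -> (forall i j, 0 <= A i j) ->
  (forall i, 0 < dvec A i 0) -> (forall i, 0 < qvec A i 0) ->
  opbound 1 (Gmx A).
Proof.
move=> sA A_ge0 d_gt0 q_gt0 x; rewrite mul1r -ler_sqr ?nnegrE ?l2norm_ge0 //.
rewrite !sqr_l2norm.
pose w i j := A i j / dvec A j 0.
have w_ge0 i j : 0 <= w i j by rewrite divr_ge0 // ltW.
have qE i : qvec A i 0 = \sum_j w i j.
  by rewrite qvec_invc // mxE; apply: eq_bigr => j _; rewrite invcE.
have GE i : (Gmx A *m x) i 0 = (Num.sqrt (qvec A i 0))^-1 * \sum_j w i j * x j 0.
  rewrite GmxE // -!mulmxA diagc_mulmx [LHS]mxE rsqrtcE; congr (_ * _).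
  rewrite mxE; apply: eq_bigr => j _.
  by rewrite diagc_mulmx [(\col__ _) _ _]mxE invcE mulrA.
have le_row i : (Gmx A *m x) i 0 ^+ 2 <= \sum_j w i j * x j 0 ^+ 2.
  rewrite GE exprMn exprVn sqr_sqrtr ?(ltW (q_gt0 i)) // mulrC ler_pdivrMr //.
  (* Each w x is split as (sqrt w x) (sqrt w); the squares of the second factors sum to q i, which
     cancels the prefactor. *)
  have := cauchy_schwarz_sum _ _ (fun j => Num.sqrt (w i j) * x j 0)
    (fun j => Num.sqrt (w i j)).
  rewrite qE; congr (_ ^+ 2 <= _ * _); apply: eq_bigr => j _.
  - by rewrite mulrAC -expr2 sqr_sqrtr.
  - by rewrite exprMn sqr_sqrtr.
  - by rewrite sqr_sqrtr.
apply: le_trans (ler_sum _ (fun i _ => le_row i)) _.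
rewrite exchange_big /= le_eqVlt; apply/orP; left; apply/eqP/eq_bigr => j _.
rewrite -mulr_suml -[RHS]mul1r; congr (_ * _).
rewrite -mulr_suml (_ : \sum_i A i j = dvec A j 0) ?divff ?lt0r_neq0 //.
by rewrite dvecE; apply: eq_bigr => i _; rewrite -[in LHS]sA mxE.
Qed.

End Normalization.

(** * Perturbation of d, q and G *)

Lemma l2norm_le_entries {R : realType} {n : nat} (c : R) (x y : 'cV[R]_n) :
  0 <= c -> (forall i, `|x i 0| <= c * `|y i 0|) -> l2norm x <= c * l2norm y.
Proof.
move=> c0 xy; rewrite -ler_sqr ?nnegrE ?mulr_ge0 ?l2norm_ge0 // exprMn !sqr_l2norm.
rewrite mulr_sumr; apply: ler_sum => i _.
rewrite -(real_normK (num_real (x i 0))) -(real_normK (num_real (y i 0))) -exprMn.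
by rewrite ler_sqr ?nnegrE ?mulr_ge0.
Qed.

Lemma ler_norm_subV {R : realFieldType} (c a b : R) : 0 < c -> c <= a -> c <= b ->
  `|a^-1 - b^-1| <= (c ^+ 2)^-1 * `|a - b|.
Proof.
move=> c0 ca cb; have a0 := lt_le_trans c0 ca; have b0 := lt_le_trans c0 cb.
have -> : a^-1 - b^-1 = (b - a) / (a * b) by field; rewrite !lt0r_neq0.
rewrite normrM distrC mulrC ler_wpM2r // ger0_norm ?invr_ge0 ?mulr_ge0 ?(ltW a0) ?(ltW b0) //.
by rewrite lef_pV2 ?posrE ?mulr_gt0 // expr2 ler_pM // ltW.
Qed.

(** Apply the Lipschitz bound for inverses to the square roots and use |a - b| = |sqrt a - sqrt b|
    (sqrt a + sqrt b), whose last factor is at least 2 sqrt c. This is the source of the term with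
    exponent 3/2. *)
Lemma ler_norm_sub_rsqrt {R : rcfType} (c a b : R) : 0 < c -> c <= a -> c <= b ->
  `|(Num.sqrt a)^-1 - (Num.sqrt b)^-1| <= (2 * (c * Num.sqrt c))^-1 * `|a - b|.
Proof.
move=> c0 ca cb; have a0 := lt_le_trans c0 ca; have b0 := lt_le_trans c0 cb.
rewrite -{2}(sqr_sqrtr (ltW a0)) -{2}(sqr_sqrtr (ltW b0)) -{1}(sqr_sqrtr (ltW c0)).
have : Num.sqrt c <= Num.sqrt a by rewrite ler_wsqrtr.
have : Num.sqrt c <= Num.sqrt b by rewrite ler_wsqrtr.
have : 0 < Num.sqrt c by rewrite sqrtr_gt0.
have : 0 < Num.sqrt a by rewrite sqrtr_gt0.
have : 0 < Num.sqrt b by rewrite sqrtr_gt0.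
move: (Num.sqrt a) (Num.sqrt b) (Num.sqrt c) => s t e t0 s0 e0 et es.
rewrite subr_sqr normrM (ger0_norm (addr_ge0 (ltW s0) (ltW t0))).
apply: le_trans (ler_norm_subV _ _ _ e0 es et) _.
have -> : (2 * (e ^+ 2 * e))^-1 * (`|s - t| * (s + t))
    = (e ^+ 2)^-1 * `|s - t| * ((s + t) / (2 * e)) by field; rewrite lt0r_neq0.
rewrite ler_peMr ?mulr_ge0 ?invr_ge0 ?sqr_ge0 //.
rewrite ler_pdivlMr; lra.
Qed.

Section Perturbation.
Context {R : realType} {n : nat}.

(** Cyclicity of the trace gathers Y V X into one factor in front of the positive semidefinite B. *)
Lemma trace_mul4_le (x v y : R) (V X B Y : 'M[R]_n) :
  0 <= x -> 0 <= v -> 0 <= y ->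
  opbound x X -> opbound v V -> opbound y Y -> psd B ->
  \tr (V *m (X *m B *m Y)) <= v * (x * y * \tr B).
Proof.
move=> x0 v0 y0 hX hV hY psdB.
rewrite !mulmxA mxtrace_mulC !mulmxA.
have -> : v * (x * y * \tr B) = y * v * x * \tr B by ring.
apply: psd_trace_mul_le psdB.
by apply: opbound_mul hX; [rewrite mulr_ge0|apply: opbound_mul].
Qed.

Variables (A B : 'M[R]_n) (dmin qmin dd dq : R).
Hypotheses (dmin_gt0 : 0 < dmin) (qmin_gt0 : 0 < qmin).
Hypotheses (dd_gt0 : 0 < dd) (dq_gt0 : 0 < dq).
Hypotheses (psdB : psd B) (psdAB : psd (A - B)).
Hypotheses (dmin_le : forall i, dmin <= dvec A i 0)
  (qmin_le : forall i, qmin <= qvec A i 0).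
Hypotheses (dd_leA : forall i, dd <= dvec A i 0) (dd_leB : forall i, dd <= dvec B i 0).
Hypotheses (dq_leA : forall i, dq <= qvec A i 0) (dq_leB : forall i, dq <= qvec B i 0).

Let tau := \tr (A - B).

Lemma l2norm_invc_dvecB :
  l2norm (invc (dvec A) - invc (dvec B)) <= Num.sqrt n%:R * tau / dd ^+ 2.
Proof.
apply: (@le_trans _ _ ((dd ^+ 2)^-1 * l2norm (dvec A - dvec B))).
  apply: l2norm_le_entries; first by rewrite invr_ge0 sqr_ge0.
  by move=> i; rewrite !colBE !invcE; exact: ler_norm_subV.
rewrite mulrC ler_wpM2r ?invr_ge0 ?sqr_ge0 // /dvec -mulmxBl mulrC -l2norm_ones.
exact: psd_opbound.
Qed.

Lemma l2norm_qvecB :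
  l2norm (qvec A - qvec B)
    <= Num.sqrt n%:R * tau / dd * (1 + opnorm A / dd).
Proof.
have dA_gt0 i : 0 < dvec A i 0 := lt_le_trans dd_gt0 (dd_leA i).
have dB_gt0 i : 0 < dvec B i 0 := lt_le_trans dd_gt0 (dd_leB i).
(* The two summands account for the 1 and the [opnorm A / dd] in the last factor. *)
have -> : qvec A - qvec B =
    (A - B) *m invc (dvec B) + A *m (invc (dvec A) - invc (dvec B)).
  by rewrite !qvec_invc // mulmxBl mulmxBr [RHS]addrC addrA subrK.
have -> : Num.sqrt n%:R * tau / dd * (1 + opnorm A / dd)
    = tau * (dd^-1 * Num.sqrt n%:R) + opnorm A * (Num.sqrt n%:R * tau / dd ^+ 2).
  by field; rewrite lt0r_neq0.
apply: le_trans (l2normD _ _) _; apply: lerD.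
  apply: le_trans (psd_opbound _ psdAB _) _; rewrite ler_wpM2l ?psd_trace_ge0 //.
  rewrite -l2norm_ones; apply: l2norm_le_entries; first by rewrite invr_ge0 ltW.
  move=> i; rewrite invcE [ones _ _ _ _]mxE normr1 mulr1 ger0_norm.
    by rewrite lef_pV2 ?posrE.
  by rewrite invr_ge0 ltW.
apply: le_trans (opbound_opnorm _ _) _.
by rewrite ler_wpM2l ?opnorm_ge0 ?l2norm_invc_dvecB.
Qed.

(** Stated against an arbitrary test matrix [V], the form in which duality consumes it. *)
Lemma trace_mul_GmxB_le (v : R) (V : 'M[R]_n) : 0 <= v -> opbound v V ->
  \tr (V *m (Gmx A - Gmx B)) <=
    v * (((Num.sqrt qmin * dmin)^-1
     + (Num.sqrt n%:R * \tr A) / (Num.sqrt dq * dd ^+ 2)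
     + (Num.sqrt n%:R * \tr A) / (2 * (dq * Num.sqrt dq) * dd ^+ 2)
       * (1 + opnorm A / dd)) * tau).
Proof.
move=> v0 hV.
have dA_gt0 i : 0 < dvec A i 0 := lt_le_trans dd_gt0 (dd_leA i).
have dB_gt0 i : 0 < dvec B i 0 := lt_le_trans dd_gt0 (dd_leB i).
have tau_ge0 : 0 <= tau by exact: psd_trace_ge0.
have trB_ge0 : 0 <= \tr B by exact: psd_trace_ge0.
(* Two of the three terms below have [B] in the middle; this turns their trace into [\tr A]. *)
have trAB : \tr B <= \tr A by move: tau_ge0; rewrite /tau raddfB /= subr_ge0.
have opA_ge0 := opnorm_ge0 A.
have rsqrt_bound (c : R) : 0 < c -> (forall i, c <= qvec A i 0) ->
    opbound (Num.sqrt c)^-1 (diagc (rsqrtc (qvec A))).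
  move=> c0 cle; apply: opbound_diag => [|i]; first by rewrite invr_ge0 sqrtr_ge0.
  rewrite rsqrtcE ger0_norm ?invr_ge0 ?sqrtr_ge0 //.
  by rewrite lef_pV2 ?posrE ?sqrtr_gt0 ?ler_wsqrtr // (lt_le_trans c0).
have inv_bound (c : R) (C : 'M[R]_n) : 0 < c -> (forall i, c <= dvec C i 0) ->
    opbound c^-1 (diagc (invc (dvec C))).
  move=> c0 cle; apply: opbound_diag => [|i]; first by rewrite invr_ge0 ltW.
  rewrite invcE ger0_norm ?invr_ge0 ?(le_trans (ltW c0)) //.
  by rewrite lef_pV2 ?posrE // (lt_le_trans c0).
(* The entries of a diagonal factor are bounded by the Euclidean norm of its diagonal, here and for
   [beta]. *)
have invB_bound : opbound (Num.sqrt n%:R * tau / dd ^+ 2)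
    (diagc (invc (dvec A) - invc (dvec B))).
  apply: opbound_diag => [|i]; first by rewrite divr_ge0 ?sqr_ge0 ?mulr_ge0 ?sqrtr_ge0.
  exact: le_trans (normr_le_l2norm _ _) l2norm_invc_dvecB.
(* The Lipschitz constant of the inverse square root above [dq], times the bound of
   [l2norm_qvecB]. *)
pose beta := (2 * (dq * Num.sqrt dq))^-1
  * (Num.sqrt n%:R * tau / dd * (1 + opnorm A / dd)).
have beta_ge0 : 0 <= beta.
  by rewrite /beta !(mulr_ge0, invr_ge0, addr_ge0, sqrtr_ge0) // ltW.
have rsqrtB_bound : opbound beta (diagc (rsqrtc (qvec A) - rsqrtc (qvec B))).
  apply: opbound_diag => // i; rewrite colBE !rsqrtcE.
  apply: le_trans (ler_norm_sub_rsqrt _ _ _ dq_gt0 (dq_leA i) (dq_leB i)) _.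
  rewrite ler_wpM2l ?invr_ge0 ?mulr_ge0 ?sqrtr_ge0 ?(ltW dq_gt0) //.
  apply: le_trans _ l2norm_qvecB; apply: le_trans (normr_le_l2norm _ i).
  by rewrite colBE.
have -> : Gmx A - Gmx B =
    diagc (rsqrtc (qvec A)) *m (A - B) *m diagc (invc (dvec A))
    + diagc (rsqrtc (qvec A)) *m B *m diagc (invc (dvec A) - invc (dvec B))
    + diagc (rsqrtc (qvec A) - rsqrtc (qvec B)) *m B *m diagc (invc (dvec B)).
  rewrite !GmxE // !diagcB !(mulmxBl, mulmxBr).
  by rewrite [RHS]addrA [_ - _ + (_ - _)]addrA !subrK.
have sq_ge0 := sqrtr_ge0 (n%:R : R).
have T1 := trace_mul4_le (Num.sqrt qmin)^-1 v dmin^-1 V _ _ _ _ v0 _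
  (rsqrt_bound _ qmin_gt0 qmin_le) hV (inv_bound _ _ dmin_gt0 dmin_le) psdAB.
have T2 := trace_mul4_le (Num.sqrt dq)^-1 v _ V _ _ _ _ v0 _
  (rsqrt_bound _ dq_gt0 dq_leA) hV invB_bound psdB.
have T3 := trace_mul4_le beta v dd^-1 V _ _ _ beta_ge0 v0 _
  rsqrtB_bound hV (inv_bound _ _ dd_gt0 dd_leB) psdB.
rewrite !(mulmxDr V) !mxtraceD [(_ + _ + _) * tau]mulrDl [(_ + _) * tau]mulrDl.
rewrite !(mulrDr v); apply: lerD; first apply: lerD.
- apply: le_trans (T1 _ _) _; rewrite ?invr_ge0 ?sqrtr_ge0 ?(ltW dmin_gt0) //.
  by rewrite ler_wpM2l // invfM.
- apply: le_trans (T2 _ _) _; rewrite ?invr_ge0 ?sqrtr_ge0 //.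
    by rewrite divr_ge0 ?sqr_ge0 ?mulr_ge0.
  rewrite ler_wpM2l //.
  have -> : Num.sqrt n%:R * \tr A / (Num.sqrt dq * dd ^+ 2) * tau
      = (Num.sqrt dq)^-1 * (Num.sqrt n%:R * tau / dd ^+ 2) * \tr A.
    by field; rewrite ?lt0r_neq0 ?sqrtr_gt0.
  by rewrite ler_wpM2l // mulr_ge0 ?invr_ge0 ?sqrtr_ge0 // divr_ge0 ?sqr_ge0 ?mulr_ge0.
- apply: le_trans (T3 _) _; first by rewrite invr_ge0 ltW.
  rewrite ler_wpM2l //.
  have -> : Num.sqrt n%:R * \tr A / (2 * (dq * Num.sqrt dq) * dd ^+ 2)
      * (1 + opnorm A / dd) * tau = beta / dd * \tr A.
    by rewrite /beta; field; rewrite ?lt0r_neq0 ?sqrtr_gt0.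
  by rewrite ler_wpM2l // mulr_ge0 // invr_ge0 ltW.
Qed.

End Perturbation.

(** * Minima and the final estimate *)

Lemma vmin_le {R : realType} {n : nat} (v : 'cV[R]_n) i : vmin v <= v i 0.
Proof.
(* The default is generalized because the head of [s] changes along the induction. *)
rewrite /vmin; set s := [seq _ | _ : _]; move: (head _ _) => x0.
have : v i 0 \in s by exact: fintype.image_f.
elim: s => // x s IH; rewrite inE big_cons ge_min => /predU1P [->|/IH ->].
  by rewrite lexx.
by rewrite orbT.
Qed.

Lemma lt_vmin {R : realType} {n : nat} (c : R) (v : 'cV[R]_n) :
  (0 < n)%N -> (forall i, c < v i 0) -> c < vmin v.
Proof.
move=> n_gt0 cv; rewrite /vmin; set s := [seq _ | _ : _].
have s_gt x : x \in s -> c < x by move=> /mapP [i _ ->].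
rewrite big_seq; apply: (big_ind (fun x => c < x)) => [|x y cx cy|x /s_gt //]; last by rewrite lt_min cx.
(* Nonemptiness makes the default [head 0 s] an entry of [v]. *)
have : (0 < size s)%N by rewrite size_map size_enum_ord.
by clearbody s; case: s s_gt => // x s s_gt _; apply: s_gt; rewrite mem_head.
Qed.

Lemma powR3half {R : realType} (x : R) : 0 < x -> x `^ (3 / 2) = x * Num.sqrt x.
Proof.
move=> x0; rewrite (_ : 3 / 2 = 1 + 2^-1); last by field.
by rewrite powRD ?(lt0r_neq0 x0) ?implybT // powRr1 ?powR12_sqrt // ltW.
Qed.

Theorem theorem7 (R : realType) (d N r : nat)
    (k : 'rV[R]_d -> 'rV[R]_d -> R) (u : 'I_N -> 'rV[R]_d) (Kt : 'M[R]_N) :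
  admissible_kernel k ->
  let K := kernel_mx k u in
  partial_cholesky r K Kt ->
  (forall i, 0 < dvec Kt i 0) ->
  (forall i, 0 < qvec Kt i 0) ->
  let dmin := vmin (dvec K) in
  let qmin := vmin (qvec K) in
  let deltad := Num.min dmin (vmin (dvec Kt)) in
  let deltaq := Num.min qmin (vmin (qvec Kt)) in
  trace_norm (normalized K - normalized Kt) <=
    (1 + opnorm (Gmx Kt)) *
    ((Num.sqrt qmin * dmin)^-1
     + (Num.sqrt N%:R * \tr K) / (Num.sqrt deltaq * deltad ^+ 2)
     + (Num.sqrt N%:R * \tr K) / (2 * deltaq `^ (3 / 2) * deltad ^+ 2)
       * (1 + opnorm K / deltad)) *
    \tr (K - Kt).
Proof.
move=> kP K [rN _ Kt0 KtK] dt_gt0 qt_gt0; cbv zeta.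
set dmin := vmin (dvec K); set qmin := vmin (qvec K).
set deltad := Num.min dmin _; set deltaq := Num.min qmin _.
(* The strict rank bound excludes N = 0, where the minima would be 0. *)
have N_gt0 : (0 < N)%N by apply: leq_ltn_trans rN.
have K_gt0 i j : 0 < K i j by rewrite mxE; exact: kernel_pos kP _ _.
have sK : K^T = K by apply/matrixP => i j; rewrite !mxE; exact: kernel_sym kP _ _.
have psdKt : psd Kt by rewrite -[Kt]subr0.
have [sKt _] := psdKt.
have sum_gt0 (f : 'I_N -> R) : (forall j, 0 < f j) -> 0 < \sum_j f j.
  move=> f_gt0; rewrite (bigD1 (Ordinal N_gt0)) //= ltr_wpDr //.
  by apply: sumr_ge0 => j _; exact: ltW.
have d_gt0 i : 0 < dvec K i 0 by rewrite dvecE; exact: sum_gt0.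
have q_gt0 i : 0 < qvec K i 0.
  rewrite qvec_invc // mxE; apply: sum_gt0 => j.
  by rewrite invcE divr_gt0.
have dmin_gt0 : 0 < dmin by exact: lt_vmin.
have qmin_gt0 : 0 < qmin by exact: lt_vmin.
have dd_gt0 : 0 < deltad by rewrite lt_min dmin_gt0 lt_vmin.
have dq_gt0 : 0 < deltaq by rewrite lt_min qmin_gt0 lt_vmin.
rewrite powR3half //.
set bracket := (_ + _ + _).
have GB_le (v : R) (V : 'M[R]_N) : 0 <= v -> opbound v V ->
    \tr (V *m (Gmx K - Gmx Kt)) <= v * (bracket * \tr (K - Kt)).
  apply: trace_mul_GmxB_le => // i; rewrite ?ge_min ?vmin_le ?orbT //.
(* Entrywise positivity is known for [K] only: [Kt] may have negative entries, so its factor keeps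
   its own operator norm in the bound. *)
have hG : opbound 1 (Gmx K) by apply: opbound_Gmx => // i j; exact: ltW.
have hGt := opbound_opnorm (Gmx Kt).
have Gt_ge0 := opnorm_ge0 (Gmx Kt).
apply: trace_norm_le => W hW.
rewrite !normalized_Gmx //.
set G := Gmx K in hG GB_le *; set Gt := Gmx Kt in hGt Gt_ge0 GB_le *.
(* G^T G - Gt^T Gt = G^T (G - Gt) + (G - Gt)^T Gt; transposing under the trace brings the second
   term to the form of the first, with test matrices of bounds 1 and |Gt|. *)
have -> : \tr (W *m (G^T *m G - Gt^T *m Gt))
    = \tr (W *m G^T *m (G - Gt)) + \tr (W^T *m Gt^T *m (G - Gt)).
  have -> : W *m (G^T *m G - Gt^T *m Gt)
      = W *m G^T *m (G - Gt) + W *m (G - Gt)^T *m Gt.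
    rewrite [(G - Gt)^T]linearB /= !(mulmxBr, mulmxBl) !mulmxA.
    by rewrite addrA subrK.
  rewrite mxtraceD; congr (_ + _); rewrite -mxtrace_tr !trmx_mul trmxK.
  by rewrite mulmxA mxtrace_mulC mulmxA.
rewrite -mulrA mulrDl; apply: lerD; apply: GB_le => //.
  by rewrite -(mulr1 1); apply: opbound_mul => //; exact: opbound_trmx.
rewrite -(mul1r (opnorm _)); apply: opbound_mul => //; exact: opbound_trmx.
Qed.
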